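(* For every real number $\epsilon$ with $0<\epsilon<\frac{1}{2}$, there exists an integer $\delta_0$ such that every digraph $D$ with $\delta^+(D)\geq \delta_0$ and $\Delta^-(D)\leq \frac{e^{\epsilon^2(\delta^+(D)-1)}}{8\,\delta^+(D)}$ admits a bisection $(A,B)$ of $V(D)$ with $\min\{d_A^+(v), d_B^+(v)\}\geq \left(\frac{1}{2}-\epsilon\right) d_D^+(v)$ for every $v\in V(D)$.
   Context: All digraphs are finite and simple (no loops, no multiple arcs). For a digraph $D$, $d_D^+(v)$ is the out-degree of $v$ in $D$, $\delta^+(D)$ is the minimum out-degree of $D$, and $\Delta^-(D)$ is the maximum in-degree of $D$. For a set $A$ of vertices, $d_A^+(v)$ denotes the number of out-neighbors of $v$ lying in $A$ (here $v$ may or may not belong to $A$). A bipartition $(A,B)$ of $V(D)$ is a partition of $V(D)$ into two disjoint sets $A$ and $B$; a bisection is a bipartition $(A,B)$ with $\big||A|-|B|\big|\leq 1$. Here $e$ is the base of the natural logarithm. *)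

(* Defs.v *)
From HB Require Import structures.
From mathcomp Require Import all_boot all_order all_algebra.
From mathcomp Require Import reals sequences exp.

Set Implicit Arguments.
Unset Strict Implicit.
Unset Printing Implicit Defensive.

(* A simple digraph on the vertex set V is an irreflexive D : rel V, where
   D u v means that there is an arc from u to v; opposite arcs are allowed. *)

Definition outdeg_in (V : finType) (D : rel V) (A : {set V}) (v : V) : nat :=
  #|[set u in A | D v u]|.

Definition outdeg (V : finType) (D : rel V) (v : V) : nat :=
  #|[set u | D v u]|.

Definition indeg (V : finType) (D : rel V) (v : V) : nat :=
  #|[set u | D u v]|.

(* The default value #|V| bounds every out-degree, so that it does not affect
   the minimum unless V is empty, in which case the value is 0. *)
Definition min_outdeg (V : finType) (D : rel V) : nat :=
  \big[minn/#|V|]_(v : V) outdeg D v.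

Definition max_indeg (V : finType) (D : rel V) : nat :=
  \max_(v : V) indeg D v.

(* The parts may be empty. *)
Definition bipartition (V : finType) (A B : {set V}) : Prop :=
  A :|: B = [set: V] /\ A :&: B = set0.

Definition bisection (V : finType) (A B : {set V}) : Prop :=
  bipartition A B /\ (`|#|A|%:Z - #|B|%:Z| <= 1)%R.

(* Main.v *)
(** Pair up the vertices (one may stay alone) and let a fair coin per pair decide
    which of its two members goes to [A]: the result is always a bisection.
    Cut every out-neighbourhood into chunks whose sizes lie in
    [[delta, 2 delta)]; it is enough to split each chunk [C] almost evenly. A
    pair inside [C] splits evenly, so a Chernoff bound shows that [C] is
    unbalanced with probability at most [p = 2 exp (- 6/5 eps^2 delta)]. Two
    chunks are dependent only if some pair meets both, so a chunk conflicts with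
    at most [4 delta Delta^- <= exp (eps^2 (delta - 1)) / 2] others, and the
    symmetric local lemma applies as soon as [eps^2 delta] is large. *)

Require Import Defs.
From HB Require Import structures.
From mathcomp Require Import all_boot all_order all_algebra.
From mathcomp Require Import reals sequences exp.
From mathcomp Require Import ring lra zify.

Set Implicit Arguments.
Unset Strict Implicit.
Unset Printing Implicit Defensive.

Import Order.TTheory GRing.Theory Num.Theory.
Local Open Scope ring_scope.

(** * Symmetric local lemma, by counting points of a product space *)

Definition depends_on (K X : finType) (T : {set K}) (F : {set {ffun K -> X}}) :=
  forall f g : {ffun K -> X}, {in T, f =1 g} -> (f \in F) = (g \in F).

(* Exchanging the coordinates outside [T] of a pair of points is an involution
   that carries [(F :&: G) * setT] onto [F * G]. *)
Lemma card_independent (K X : finType) (T : {set K})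
    (F G : {set {ffun K -> X}}) :
  depends_on T F -> depends_on (~: T) G ->
  (#|F :&: G| * #|{ffun K -> X}| = #|F| * #|G|)%N.
Proof.
move=> dF dG.
pose mix (f g : {ffun K -> X}) := [ffun x => if x \in T then f x else g x].
pose sw (u : {ffun K -> X} * {ffun K -> X}) := (mix u.1 u.2, mix u.2 u.1).
have swK : involutive sw.
  by case=> f g; rewrite /sw /=; congr (_, _); apply/ffunP => x;
    rewrite !ffunE; case: (x \in T).
have mixF f g : (mix f g \in F) = (f \in F).
  by apply: dF => x xT; rewrite ffunE xT.
have mixG f g : (mix f g \in G) = (g \in G).
  by apply: dG => x; rewrite inE ffunE => /negbTE->.
rewrite -cardsT -!cardsX -(card_preimset _ (inv_inj swK)).
by apply: eq_card => -[f g]; rewrite !inE /= mixF mixG andbT.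
Qed.

Lemma leq_card_bigcup (I T : finType) (P : pred I) (F : I -> {set T}) :
  (#|\bigcup_(i | P i) F i| <= \sum_(i | P i) #|F i|)%N.
Proof.
elim/big_rec2: _ => [|i m A _ leAm]; first by rewrite cards0.
by rewrite (leq_trans (leq_card_setU _ _)) // leq_add2l.
Qed.

Definition avoid (K X I : finType) (bad : I -> {set {ffun K -> X}})
    (S : {set I}) := ~: \bigcup_(j in S) bad j.

Lemma avoidP (K X I : finType) (bad : I -> {set {ffun K -> X}})
    (S : {set I}) f :
  reflect (forall j, j \in S -> f \notin bad j) (f \in avoid bad S).
Proof.
rewrite inE; apply: (iffP idP) => [/bigcupP nf j jS | nf].
  by apply/negP => fj; apply: nf; exists j.
by apply/bigcupP => -[j jS]; apply/negP/nf.
Qed.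

Section LocalLemma.
Variables (R : realFieldType) (K X I : finType) (T : I -> {set K}).
Variables (bad : I -> {set {ffun K -> X}}) (E : {set I}) (p : R).
Hypothesis bad_dep : forall i, depends_on (T i) (bad i).
Hypothesis bad_p : forall i, i \in E ->
  #|bad i|%:R <= p * #|{ffun K -> X}|%:R.
Hypothesis p_ge0 : 0 <= p.
Hypothesis p_lt : p < 1 / 2.
Hypothesis deg_p : forall i, i \in E ->
  4 * p * #|[set j in E | ~~ [disjoint T i & T j]]|%:R <= 1.
Hypothesis x0 : X.

(** Induction on [#|S|]: [bad i] is independent of the events in [S2], and the events in [S1], at
    most [1 / (4 p)] of them, remove at most half of [avoid bad S2]. Passing from [S2] back to [S]
    thus costs the factor 2 in [2 * p]. *)
Lemma local_lemma_conditional (S : {set I}) i : S \subset E -> i \in E ->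
  #|bad i :&: avoid bad S|%:R <= 2 * p * #|avoid bad S|%:R.
Proof.
have [n] := ubnP #|S|; elim: n S i => // n IH S i /ltnSE leSn SE iE.
pose S1 := [set j in S | ~~ [disjoint T i & T j]].
pose S2 := [set j in S | [disjoint T i & T j]].
have S2S : S2 \subset S by apply/subsetP => j; rewrite inE => /andP[].
(* Every [T j] with [j] in [S2] misses [T i], so [avoid bad S2] depends only on the coordinates
   outside [T i]. *)
have indep : #|bad i :&: avoid bad S2|%:R <= p * #|avoid bad S2|%:R.
  have dep2 : depends_on (~: T i) (avoid bad S2).
    move=> f g fg; have same j : j \in S2 -> (f \in bad j) = (g \in bad j).
      rewrite inE => /andP[_ dij]; apply: bad_dep => x xT.
      by apply: fg; rewrite inE (disjointFl dij).
    by apply/avoidP/avoidP => h j jS2; have := h j jS2; rewrite same.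
  have := card_independent (@bad_dep i) dep2.
  move/(congr1 (fun m : nat => m%:R : R)); rewrite !natrM => eqc.
  have Om_gt0 : (0 : R) < #|{ffun K -> X}|%:R.
    by rewrite ltr0n; apply/card_gt0P; exists [ffun=> x0].
  rewrite -(ler_pM2r Om_gt0) eqc mulrAC ler_wpM2r ?ler0n //.
  exact: bad_p.
have split2 : (#|avoid bad S2| <=
    #|avoid bad S| + \sum_(j in S1) #|bad j :&: avoid bad S2|)%N.
  apply: leq_trans (leq_add (leqnn _) (leq_card_bigcup _ _)).
  rewrite -cardsUI; apply: leq_trans (leq_addr _ _).
  apply/subset_leq_card/subsetP => f fS2; rewrite inE.
  have [//|] := boolP (f \in avoid bad S).
  rewrite inE negbK => /bigcupP[j jS fj]; apply/bigcupP; exists j.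
    rewrite inE jS; apply/negP => dij; move/avoidP: fS2 => /(_ j).
    by rewrite inE jS dij fj => /(_ isT).
  by rewrite inE fj.
have half : \sum_(j in S1) #|bad j :&: avoid bad S2|%:R <=
    (1 / 2) * #|avoid bad S2|%:R :> R.
  have le1 : \sum_(j in S1) #|bad j :&: avoid bad S2|%:R <=
      \sum_(j in S1) 2 * p * #|avoid bad S2|%:R :> R.
    (* The induction hypothesis applies to [S2] because [j] lies in [S] but not in [S2]. *)
    apply: ler_sum => j; rewrite inE => /andP[jS ndij].
    apply: IH; rewrite ?(subset_trans S2S) ?(subsetP SE) //.
    apply: leq_trans leSn; apply/proper_card/properP; split=> //.
    by exists j => //; rewrite inE jS.
  apply: le_trans le1 _; rewrite sumr_const -mulrnAl ler_wpM2r ?ler0n //.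
  have S1E : (#|S1| <= #|[set j in E | ~~ [disjoint T i & T j]]|)%N.
    apply/subset_leq_card/subsetP => j; rewrite !inE => /andP[jS ->].
    by rewrite (subsetP SE).
  have : 4 * p * #|S1|%:R <= 1.
    apply: le_trans (deg_p iE); rewrite ler_wpM2l ?ler_nat //.
    by rewrite mulr_ge0.
  rewrite -mulr_natr; lra.
have : #|bad i :&: avoid bad S|%:R <= #|bad i :&: avoid bad S2|%:R :> R.
  rewrite ler_nat; apply/subset_leq_card/setIS/subsetP => f /avoidP h.
  by apply/avoidP => j /(subsetP S2S); apply: h.
move: split2; rewrite -(ler_nat R) natrD natr_sum => split2 mono.
have le2 : #|avoid bad S2|%:R <= 2 * #|avoid bad S|%:R :> R by lra.
by have := ler_wpM2l p_ge0 le2; lra.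
Qed.

(** Adding one event to those avoided keeps at least a fraction [1 - 2 p > 0] of the remaining
    points. *)
Lemma local_lemma : exists f, forall i, i \in E -> f \notin bad i.
Proof.
suff /(_ E (subxx _)) : forall S : {set I}, S \subset E ->
    (0 < #|avoid bad S|)%N.
  by case/card_gt0P => f /avoidP; exists f.
move=> S; have [n] := ubnP #|S|; elim: n S => // n IH S /ltnSE leSn SE.
have [->|[i iS]] := set_0Vmem S.
  by apply/card_gt0P; exists [ffun=> x0]; apply/avoidP => j; rewrite inE.
have S'E : S :\ i \subset E by apply: subset_trans SE; exact: subD1set.
have iE := subsetP SE i iS.
have : (0 < #|avoid bad (S :\ i)|)%N.
  by apply: IH => //; move: leSn; rewrite (cardsD1 i) iS.
have -> : avoid bad S = avoid bad (S :\ i) :\: bad i.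
  apply/setP => f; apply/avoidP/setDP => [h|[/avoidP h nf] j jS].
    by split; [apply/avoidP => j /setD1P[_ /h] | apply: h].
  by have [->//|ji] := eqVneq j i; apply: h; rewrite !inE ji.
have := local_lemma_conditional S'E iE.
rewrite -!(ltr_nat R) -(cardsID (bad i) (avoid bad (S :\ i))) natrD setIC.
set a := _%:R; set b := #|_ :\: _|%:R.
rewrite mulr0n => le1 ab; have : 0 < (1 - 2 * p) * (a + b).
  by apply: mulr_gt0 => //; move: p_lt; lra.
lra.
Qed.

End LocalLemma.

(** * Cutting into chunks, and cancellation in pairs *)

(** Split off [d] elements as long as at least [2 d] remain; what is left never drops below [d] and
    forms the last chunk. *)
Lemma exists_chunks (V : finType) (d : nat) (S : {set V}) : (0 < d)%N ->
  (d <= #|S|)%N -> exists P : {set {set V}}, partition P S /\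
    {in P, forall C : {set V}, (d <= #|C| < d.*2)%N}.
Proof.
move=> d_gt0; have [n] := ubnP #|S|; elim: n S => // n IH S /ltnSE leSn dS.
have [ltS|geS] := ltnP #|S| d.*2.
  have S0 : S != set0 by rewrite -card_gt0; apply: leq_trans dS.
  exists [set S]; split; last by move=> C /set1P->; rewrite dS.
  by rewrite /partition /cover big_set1 eqxx trivIset1 in_set1 eq_sym.
have /card_geqP[s [s_uniq s_size sS]] := dS.
pose C := [set x in s].
have cC : #|C| = d by rewrite cardsE (card_uniqP s_uniq).
have CS : C \subset S by apply/subsetP => x; rewrite inE => /sS.
have cD : #|S :\: C| = (#|S| - d)%N by rewrite cardsDS // cC.
have [||P [partP sizeP]] := IH (S :\: C).
- by rewrite cD; apply: leq_trans leSn; rewrite ltn_subrL d_gt0 (leq_trans _ dS).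
- by rewrite cD leq_subRL // addnn.
exists (C |: P); split.
  rewrite -(setID S C) (setIidPr CS); apply: partitionU1 => //.
    by rewrite -card_gt0 cC.
  by rewrite disjoint_sym disjoints_subset subsetDr.
move=> C' /setU1P[->|/sizeP//].
by rewrite cC leqnn -addnn -[X in (X < _)%N]addn0 ltn_add2l.
Qed.

(** The terms of index [2 j] and [2 j + 1] cancel, so only an unpaired last term survives. *)
Lemma sum_alternating_pairs (c : nat -> int) n :
  \sum_(i < n) (-1) ^+ i * c i./2 = if odd n then c n./2 else 0.
Proof.
elim: n => [|n IH]; first by rewrite big_ord0.
rewrite big_ord_recr /= IH -signr_odd uphalf_half.
by case: (odd n); rewrite ?expr1 ?expr0; ring.
Qed.

(** * Exponential estimates *)

Lemma expR_le_inv (R : realType) (h : R) : h < 1 -> expR h <= (1 - h)^-1.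
Proof.
move=> h1; rewrite -(invrK (expR h)) -expRN lef_pV2 ?posrE ?expR_gt0 ?subr_gt0 //.
exact: expR_ge1Dx.
Qed.

(* The sharp constant is 1/2. With constant [a] and [t = eps] the tail decays
   like [exp (- (2 - a) eps^2 delta)], which beats the growth
   [exp (eps^2 delta)] of the conflict count as soon as [a < 1]. *)
Lemma expR_cosh_le (R : realType) (t : R) : `|t| <= 1 / 2 ->
  expR t + expR (- t) <= 2 * expR (4 / 5 * t ^+ 2).
Proof.
rewrite ler_norml => /andP[tl tu].
(* Halving the argument matters: the plain bound [1 / (1 - x)] would only give the quadratic
   coefficient 1. *)
have sq (x : R) : x < 2 -> expR x <= ((1 - x / 2) ^+ 2)^-1.
  move=> x1; have -> : expR x = expR (x / 2) ^+ 2.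
    by rewrite -expRM_natl; congr expR; lra.
  rewrite -exprVn lerXn2r ?nnegrE ?expR_ge0 ?expR_le_inv ?invr_ge0; lra.
pose y := (t / 2) ^+ 2.
have y0 : 0 <= y by exact: sqr_ge0.
have y1 : y <= 1 / 16 by rewrite /y; nra.
have inv_y : (1 - y)^-1 <= expR (11 / 10 * y).
  apply: le_trans (expR_ge1Dx _); rewrite -div1r ler_pdivrMr; nra.
have le1 : expR t + expR (- t) <= 2 * ((1 + y) * (1 - y)^-1 ^+ 2).
  apply: le_trans (lerD (sq _ _) (sq _ _)) _; [lra|lra|].
  rewrite le_eqVlt; apply/orP; left; apply/eqP.
  by rewrite /y; field; rewrite !subr_eq0 /=; nra.
apply: (le_trans le1); rewrite ler_pM2l //.
(* Source of the constant 4/5: the factor [1 + y] costs [y], each factor [1 / (1 - y)] costs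
   [11/10 y], and [y = t^2 / 4]. *)
have -> : 4 / 5 * t ^+ 2 = y + 11 / 10 * y *+ 2 by rewrite /y; field.
rewrite expRD -mulr_natl expRM_natl; apply: ler_pM => //.
- lra.
- by rewrite exprn_ge0 // invr_ge0; lra.
- exact: expR_ge1Dx.
- by rewrite lerXn2r ?nnegrE ?expR_ge0 // invr_ge0; lra.
Qed.

(** * Chernoff bound for the paired colouring *)

Section PairedColoring.
Variables (R : realType) (V K : finType) (key : V -> K) (sgn : V -> bool).
Hypothesis key_sgn_inj : injective (fun v => (key v, sgn v)).

(* The coin of a key is reversed on the member of the pair with [sgn v = true],
   so that the two members always fall on opposite sides. *)
Definition side (f : {ffun K -> bool}) : {set V} :=
  [set v | f (key v) (+) sgn v].

(** The exponential factors over the keys, and independence of the coins turns the mean of the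
    product into a product of means, each bounded by [expR_cosh_le]. *)
Lemma side_mgf (t : R) (C : {set V}) : `|t| <= 1 / 2 ->
  \sum_(f : {ffun K -> bool})
     expR (\sum_(v in C) t * (-1) ^+ (f (key v) (+) sgn v))
  <= #|{ffun K -> bool}|%:R * expR (4 / 5 * t ^+ 2 * #|C|%:R).
Proof.
move=> t_small.
pose F k b := \prod_(v in C | key v == k) expR (t * (-1) ^+ (b (+) sgn v)).
rewrite (eq_bigr (fun f : {ffun K -> bool} => \prod_k F k (f k))); last first.
  move=> f _; rewrite expR_sum (partition_big key predT) //=.
  apply: eq_bigr => k _; apply: eq_bigr => v /andP[_ /eqP <-] //.
have -> : \sum_(f : {ffun K -> bool}) \prod_k F k (f k) =
    \prod_k \sum_b F k b by rewrite bigA_distr_bigA.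
pose m k := (\sum_(v in C | key v == k) 1)%N.
have Fk k : \sum_b F k b <= 2 * expR (4 / 5 * t ^+ 2 * (m k)%:R).
  have cnt b : (#|[set v in C | (key v == k) && (sgn v == b)]| <= 1)%N.
    apply/card_le1_eqP => u v; rewrite !inE.
    move=> /and3P[_ /eqP ku /eqP su] /and3P[_ /eqP kv /eqP sv].
    by apply: key_sgn_inj; rewrite ku su kv sv.
  pose n b := #|[set v in C | (key v == k) && (sgn v == b)]|.
  pose x : R := (n false)%:R - (n true)%:R.
  have FE b : F k b = expR ((-1) ^+ b * (t * x)).
    rewrite /F -expR_sum; congr expR.
    rewrite (bigID sgn) /= (eq_bigr (fun=> - ((-1) ^+ b * t))); last first.
      by move=> v /andP[_ ->]; rewrite addbT signrN mulrN mulrC.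
    rewrite addrC (eq_bigr (fun=> (-1) ^+ b * t)); last first.
      by move=> v /andP[_ /negbTE->]; rewrite addbF mulrC.
    rewrite !sumr_const.
    have -> : #|[pred v | (v \in C) && (key v == k) & ~~ sgn v]| = n false.
      by apply: eq_card => v; rewrite !inE eqbF_neg andbA.
    have -> : #|[pred v | (v \in C) && (key v == k) & sgn v]| = n true.
      by apply: eq_card => v; rewrite !inE eqb_id andbA.
    rewrite -[_ *+ n true]mulr_natr -[_ *+ n false]mulr_natr /x; ring.
  have mE : m k = (n false + n true)%N.
    rewrite /m (bigID sgn) /= addnC !sum1_card; congr (_ + _)%N.
      by apply: eq_card => v; rewrite !inE eqbF_neg andbA.
    by apply: eq_card => v; rewrite !inE eqb_id andbA.
  rewrite big_bool !FE expr1 expr0 mulN1r mul1r [leLHS]addrC.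
  (* A full pair inside [C] cancels to [x = 0]; a lone member gives [x = 1] or [x = -1] with
     [m k = 1]. *)
  have [xm x1] : x ^+ 2 <= (m k)%:R /\ `|x| <= 1.
    rewrite mE /x; have := cnt true; have := cnt false; rewrite -!/(n _).
    case: (n true) => [|[|//]]; case: (n false) => [|[|//]] _ _;
      by split; rewrite ?ler_norml; lra.
  apply: le_trans (expR_cosh_le _) _.
    by rewrite normrM -[1 / 2]mulr1 ler_pM.
  rewrite ler_pM2l // ler_expR exprMn mulrA ler_wpM2l //.
  by rewrite mulr_ge0 ?sqr_ge0 //; lra.
have prodF : \prod_k \sum_b F k b <=
    \prod_k (2 * expR (4 / 5 * t ^+ 2 * (m k)%:R)).
  apply: ler_prod.
  move=> k _; rewrite Fk sumr_ge0 // => b _.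
  by rewrite prodr_ge0 // => v _; exact: expR_ge0.
apply: (le_trans prodF); rewrite big_split /= prodr_const.
rewrite -expR_sum -mulr_sumr -natr_sum.
rewrite card_ffun card_bool natrX ler_pM2l ?exprn_gt0 //.
by rewrite -sum1_card (partition_big key predT).
Qed.

Lemma side_imbalance (f : {ffun K -> bool}) (C : {set V}) :
  \sum_(v in C) (-1) ^+ (f (key v) (+) sgn v)
  = #|C :\: side f|%:R - #|C :&: side f|%:R :> R.
Proof.
rewrite (bigID (mem (side f))) /= (eq_bigr (fun=> -1)); last first.
  by move=> v /andP[_]; rewrite inE => ->.
rewrite addrC (eq_bigr (fun=> 1)); last first.
  by move=> v /andP[_]; rewrite inE => /negbTE->.
rewrite !sumr_const mulNrn; congr (_%:R - _%:R).
  by apply: eq_card => v; rewrite [LHS]unfold_in /= !inE andbC.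
by apply: eq_card => v; rewrite [LHS]unfold_in /= !inE.
Qed.

Definition balanced (eps : R) (C A : {set V}) :=
  (1 / 2 - eps) * #|C|%:R <= (minn #|C :&: A| #|C :\: A|)%:R.

(** Markov's inequality for the exponential moment; the exponent is [4/5 - 2 = - 6/5]. The sign of
    [t] selects which side is the small one. *)
Lemma side_tail (eps t : R) (C : {set V}) : eps < 1 / 2 -> `|t| = eps ->
  #|[set f | 2 * eps ^+ 2 * #|C|%:R <=
     t * (#|C :\: side f|%:R - #|C :&: side f|%:R)]|%:R
  <= expR (- (6 / 5 * eps ^+ 2 * #|C|%:R)) * #|{ffun K -> bool}|%:R.
Proof.
move=> eps_lt t_eps; set B := [set f | _].
have t2 : t ^+ 2 = eps ^+ 2 by rewrite -t_eps real_normK ?num_real.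
have markov : #|B|%:R * expR (2 * eps ^+ 2 * #|C|%:R) <=
    #|{ffun K -> bool}|%:R * expR (4 / 5 * eps ^+ 2 * #|C|%:R).
  rewrite -t2; apply: le_trans (side_mgf _ _); last by rewrite t_eps ltW.
  rewrite t2 mulr_natl -sumr_const big_mkcond /=; apply: ler_sum => f _.
  case: ifP => [|_]; last exact: expR_ge0.
  by rewrite inE ler_expR -mulr_sumr side_imbalance.
rewrite -(ler_pM2r (expR_gt0 (2 * eps ^+ 2 * #|C|%:R))) (le_trans markov) //.
rewrite [leRHS]mulrAC -expRD mulrC ler_wpM2r // le_eqVlt; apply/orP; left.
by apply/eqP; congr expR; field.
Qed.

Lemma card_unbalanced (eps : R) (C : {set V}) : 0 < eps < 1 / 2 ->
  #|[set f | ~~ balanced eps C (side f)]|%:R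
  <= 2 * expR (- (6 / 5 * eps ^+ 2 * #|C|%:R)) * #|{ffun K -> bool}|%:R.
Proof.
move=> /andP[eps_gt0 eps_lt].
have tail1 := side_tail C eps_lt (gtr0_norm eps_gt0).
have tail2 := side_tail C eps_lt (etrans (normrN eps) (gtr0_norm eps_gt0)).
rewrite -mulrA mulr2n mulrDl !mul1r; apply: le_trans (lerD tail1 tail2).
rewrite -natrD ler_nat; apply: leq_trans (leq_card_setU _ _).
apply/subset_leq_card/subsetP => f; rewrite !inE -ltNge.
have cC : #|C|%:R = #|C :&: side f|%:R + #|C :\: side f|%:R :> R.
  by rewrite -natrD cardsID.
rewrite cC; set a := #|C :&: side f|; set b := #|C :\: side f|.
(* A minimum below [(1/2 - eps) (a + b)] forces a difference above [2 eps (a + b)]; multiplying by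
   [eps] gives the threshold of the tail bound. *)
have [le_ab|lt_ba] := leqP a b => min_lt; apply/orP; [left|right].
  by rewrite expr2 mulrA [_ * eps]mulrC -!mulrA ler_pM2l //; lra.
rewrite mulNr -mulrN expr2 mulrA [_ * eps]mulrC -!mulrA ler_pM2l //; lra.
Qed.

Lemma unbalanced_depends_on (eps : R) (C : {set V}) :
  depends_on (key @: C) [set f | ~~ balanced eps C (side f)].
Proof.
move=> f g fg; rewrite !inE /balanced !setDE.
have same v : v \in C -> (v \in side f) = (v \in side g).
  by move=> vC; rewrite !inE fg // imset_f.
have -> : C :&: side f = C :&: side g.
  by apply/setP => v; rewrite !in_setI; apply: andb_id2l; exact: same.
have -> // : C :&: ~: side f = C :&: ~: side g.
by apply/setP => v; rewrite !in_setI !in_setC; apply: andb_id2l => /same->.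
Qed.

End PairedColoring.

(** * From chunks to whole neighbourhoods *)

Lemma card_setI_partition (V : finType) (P : {set {set V}}) (S A : {set V}) :
  partition P S -> #|S :&: A| = (\sum_(C in P) #|C :&: A|)%N.
Proof.
move=> partP; have /and3P[/eqP covP trivP _] := partP.
have card1 (X : {set V}) : #|X :&: A| = (\sum_(x in X) (x \in A))%N.
  by rewrite -sum1_card big_mkcond /= [RHS]big_mkcond; apply: eq_bigr => x _;
    rewrite inE; case: (x \in X); case: (x \in A).
rewrite card1 -covP big_trivIset //=.
by apply: eq_bigr => C _; rewrite card1.
Qed.

(** The lower bound is linear in the size, and a sum of minima is at most the minimum of the
    sums. *)
Lemma balanced_partition (R : realType) (V : finType) (eps : R)
    (P : {set {set V}}) (S A : {set V}) : partition P S ->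
  {in P, forall C, balanced eps C A} -> balanced eps S A.
Proof.
move=> partP balP; rewrite /balanced (card_partition partP) natr_sum mulr_sumr.
apply: le_trans (ler_sum _ balP) _; rewrite -natr_sum ler_nat.
rewrite setDE !(card_setI_partition _ partP) leq_min.
by apply/andP; split; apply: leq_sum => C _; rewrite ?geq_minl // -setDE geq_minr.
Qed.

(** * The pairing and its conflicts *)

(** Enumerate the vertices and pair ranks [2 j] and [2 j + 1]: the key is half the rank, the sign
    its parity. Keys that no vertex carries are idle coins. *)
Lemma exists_pairing (V : finType) : exists (key : V -> 'I_#|V|) (sgn : V -> bool),
  injective (fun v => (key v, sgn v)) /\
  forall f, bisection (side key sgn f) (~: side key sgn f).
Proof.
pose rk (v : V) : nat := enum_rank v.
have half_lt v : ((rk v)./2 < #|V|)%N.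
  apply: (leq_ltn_trans _ (ltn_ord (enum_rank v))).
  by rewrite -[leqRHS]odd_double_half -addnn addnA leq_addl.
pose key v : 'I_#|V| := Ordinal (half_lt v).
exists key, (fun v => odd (rk v)); split.
  move=> u v [hk so]; apply: enum_rank_inj; apply: val_inj; rewrite /= -!/(rk _).
  by rewrite -[LHS]odd_double_half -[RHS]odd_double_half so hk.
move=> f; set A := side _ _ f; split; first by split; rewrite ?setUCr ?setICr.
(* Coin signs extended to all of [nat]; the default 0 is never taken at the key of a vertex. *)
pose c (i : nat) : int :=
  if insub i is Some k then (-1) ^+ f k else 0.
suff -> : #|A|%:Z - #|~: A|%:Z = - \sum_(i < #|V|) (-1) ^+ i * c i./2.
  rewrite sum_alternating_pairs normrN; case: ifP => //.
  by rewrite /c; case: insubP => // k _ _; rewrite normrX normrN1 expr1n.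
pose w v : int := if v \in A then 1 else -1.
have wE v : w v = - ((-1) ^+ (rk v) * c (rk v)./2).
  have ck : c (rk v)./2 = (-1) ^+ f (key v) by rewrite /c (valK (key v)).
  rewrite /w ck.
  rewrite inE -signr_odd -signr_addb.
  by case: (f _); case: (odd _); rewrite /= ?expr0 ?expr1 ?opprK.
have -> : #|A|%:Z - #|~: A|%:Z = \sum_v w v.
  rewrite (bigID (mem A)) /= (eq_bigr (fun=> 1)); last first.
    by move=> v vA; rewrite /w vA.
  rewrite [in RHS]addrC (eq_bigr (fun=> -1)); last first.
    by move=> v /negbTE vA; rewrite /w vA.
  rewrite !sumr_const mulNrn [in RHS]addrC !natz; congr (_%:Z - _%:Z).
  by apply: eq_card => v; rewrite [RHS]unfold_in inE.
under eq_bigr do rewrite wE.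
rewrite sumrN; congr (- _).
rewrite (reindex_onto (@enum_val V predT) enum_rank) /=; last first.
  by move=> v _; rewrite enum_rankK.
apply: eq_big => [i|i _]; first by rewrite enum_valK eqxx.
by rewrite /rk enum_valK.
Qed.

Lemma card_sharing_key (V K : finType) (key : V -> K) (sgn : V -> bool)
    (C : {set V}) : injective (fun v => (key v, sgn v)) ->
  (#|[set u | key u \in key @: C]| <= #|C|.*2)%N.
Proof.
move=> inj; rewrite -(card_imset _ inj) -muln2 -card_bool.
apply: (@leq_trans #|setX (key @: C) [set: bool]|).
  apply/subset_leq_card/subsetP => _ /imsetP[u uC ->].
  by move: uC; rewrite !inE andbT.
by rewrite cardsX cardsT leq_mul2r leq_imset_card orbT.
Qed.

(** A conflicting chunk contains some [u] whose key occurs in [C], and it is the block of [u] in the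
    out-neighbourhood of an in-neighbour [w] of [u]. There are at most [2 #|C|] choices of [u], then
    at most [max_indeg D] of [w]. *)
Lemma card_conflicts (V K : finType) (D : rel V) (key : V -> K)
    (sgn : V -> bool) (part : V -> {set {set V}}) (C : {set V}) :
  injective (fun v => (key v, sgn v)) ->
  (forall w, partition (part w) [set u | D w u]) ->
  (#|[set C' in \bigcup_w part w | ~~ [disjoint key @: C & key @: C']]|
     <= #|C|.*2 * max_indeg D)%N.
Proof.
move=> inj partP.
apply: (@leq_trans (\sum_(u in [set u | key u \in key @: C]) max_indeg D));
  last first.
  by rewrite sum_nat_const leq_mul2r (card_sharing_key _ inj) orbT.
apply: (@leq_trans #|\bigcup_(u in [set u | key u \in key @: C])
    [set pblock (part w) u | w in [set w | D w u]]|).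
  apply/subset_leq_card/subsetP => C'; rewrite inE => /andP[/bigcupP[w _ C'w]].
  case/pred0Pn => k /andP[kC /imsetP[u uC' kE]].
  apply/bigcupP; exists u; first by rewrite inE -kE.
  have /and3P[/eqP cov triv _] := partP w.
  apply/imsetP; exists w; last by rewrite (def_pblock triv C'w uC').
  rewrite inE; have : u \in [set u | D w u].
    by rewrite -cov; apply/bigcupP; exists C'.
  by rewrite inE.
apply: leq_trans (leq_card_bigcup _ _) _; apply: leq_sum => u _.
apply: leq_trans (leq_imset_card _ _) _.
exact: (leq_bigmax u).
Qed.

(** * Choice of the threshold and conclusion *)

Lemma min_outdeg_le (V : finType) (D : rel V) v :
  (min_outdeg D <= outdeg D v)%N.
Proof.
rewrite /min_outdeg; have := mem_index_enum v.
elim: (index_enum V) => // u s IH; rewrite inE big_cons geq_min.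
by case/orP => [/eqP->|/IH->]; rewrite ?leqnn ?orbT.
Qed.

Theorem theorem2 (R : realType) (eps : R) (heps : 0 < eps < 1 / 2) :
  exists delta0 : nat,
    forall (V : finType) (D : rel V), irreflexive D ->
      (delta0 <= min_outdeg D)%N ->
      (max_indeg D)%:R <=
        expR (eps ^+ 2 * ((min_outdeg D)%:R - 1)) / (8 * (min_outdeg D)%:R) ->
      exists A B : {set V},
        bisection A B /\
        forall v : V,
          (1 / 2 - eps) * (outdeg D v)%:R
            <= (minn (outdeg_in D A v) (outdeg_in D B v))%:R.
Proof.
have /andP[eps_gt0 eps_lt] := heps.
have eps2_gt0 : 0 < eps ^+ 2 by rewrite exprn_gt0.
(* With [eps^2 delta >= 15], the surplus [(6/5 - 1) eps^2 delta] is at least 3, and [exp 3 >= 4]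
   absorbs the remaining factor 4. *)
exists (Num.truncn (15 / eps ^+ 2)).+1 => V D _ delta_ge indeg_le.
set delta := min_outdeg D in delta_ge indeg_le.
have delta_gt0 : (0 < delta)%N by apply: leq_trans delta_ge.
have eps_delta : 15 <= eps ^+ 2 * delta%:R.
  rewrite mulrC -ler_pdivrMr //; apply/ltW/(lt_le_trans (truncnS_gt _)).
  by rewrite ler_nat.
have [key [sgn [inj bis]]] := exists_pairing V.
have [part partP] := fin_all_exists (fun v =>
  exists_chunks delta_gt0 (min_outdeg_le D v : (delta <= #|[set u | D v u]|)%N)).
pose E := \bigcup_w part w.
have sizeE C : C \in E -> (delta <= #|C| < delta.*2)%N.
  by case/bigcupP => w _; apply: (partP w).2.
pose p : R := 2 * expR (- (6 / 5 * eps ^+ 2 * delta%:R)).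
(* One bad event per chunk, determined by the coins of the keys it meets; [true] witnesses that the
   coin space is inhabited. *)
have [||||f good] := @local_lemma R _ _ _ (fun C : {set V} => key @: C)
    (fun C => [set f | ~~ balanced eps C (side key sgn f)]) E p
    (unbalanced_depends_on _ _) _ _ _ _ true.
- move=> C /sizeE/andP[leC _]; apply: le_trans (card_unbalanced inj _ heps) _.
  rewrite ler_wpM2r // ler_wpM2l // ler_expR lerN2 ler_wpM2l ?ler_nat //.
  by rewrite mulr_ge0 ?ltW //; lra.
- by rewrite mulr_ge0 ?expR_ge0.
- rewrite /p expRN; have := expR_ge1Dx (6 / 5 * eps ^+ 2 * delta%:R).
  set x := expR _ => x_ge; have x_gt : 4 < x by lra.
  by rewrite ltr_pdivrMr; lra.
- move=> C /sizeE/andP[_ ltC].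
  have dR : 0 < delta%:R :> R by rewrite ltr0n.
  have confl : #|[set C' in E | ~~ [disjoint key @: C & key @: C']]|%:R
      <= expR (eps ^+ 2 * (delta%:R - 1)) / 2.
    apply: (@le_trans _ _ (4 * delta%:R * (max_indeg D)%:R)).
      rewrite -!natrM ler_nat.
      apply: leq_trans (card_conflicts C inj (fun w => (partP w).1)) _.
      by rewrite leq_mul2r; apply/orP; right; lia.
    rewrite mulrC -ler_pdivlMr; last by rewrite mulr_gt0.
    apply: (le_trans indeg_le); rewrite le_eqVlt; apply/orP; left; apply/eqP.
    by field; rewrite gt_eqF.
  apply: (le_trans (ler_wpM2l _ confl)).
    by rewrite mulr_ge0 // mulr_ge0 ?expR_ge0.
  have -> : 4 * p * (expR (eps ^+ 2 * (delta%:R - 1)) / 2) =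
      4 * (expR (- (6 / 5 * eps ^+ 2 * delta%:R))
           * expR (eps ^+ 2 * (delta%:R - 1))) by rewrite /p; field.
  rewrite -expRD.
  have exp_le : expR (- (6 / 5 * eps ^+ 2 * delta%:R) +
      eps ^+ 2 * (delta%:R - 1)) <= expR (- 3) by rewrite ler_expR; lra.
  have : 4 * expR (- 3) <= 1 :> R.
    by rewrite expRN ler_pdivrMr ?expR_gt0 // mul1r; have := expR_ge1Dx (3 : R); lra.
  lra.
exists (side key sgn f), (~: side key sgn f); split=> [|v]; first exact: bis.
have := @balanced_partition R _ eps _ _ (side key sgn f) (partP v).1.
rewrite /balanced setDE /outdeg /outdeg_in !(setIC [set u | D v u]).
have inE' (A : {set V}) : [set u in A | D v u] = A :&: [set u | D v u].
  by apply/setP => u; rewrite !inE.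
rewrite !inE'; apply => C Cv; have := good C.
by rewrite inE negbK; apply; apply/bigcupP; exists v.
Qed.
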